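(* Let $0<\delta<\tfrac12$ and set $\rho=\tfrac12-\sqrt{\delta(1-\delta)}$. Then for every integer $w\ge 3$, \[ R_w(\delta)\le H(\rho)-\frac1w\log_2\!\left(1+\left(\frac{\rho}{1-\rho}\right)^w\right). \] Moreover, \[ R_3(\delta)\le\begin{cases}\tfrac23, & \delta\le \tfrac12-\tfrac{\sqrt3}{4},\\[4pt] \tfrac23 H_4(3\rho), & \delta>\tfrac12-\tfrac{\sqrt3}{4},\end{cases} \] and \[ R_4(\delta)\le H(\rho)+\tfrac14\log_2 F(\rho), \] where $H_4(x)=x\log_4 3-x\log_4 x-(1-x)\log_4(1-x)$ and $F(\rho)=(1-\rho)^4+4\rho(1-\rho)^3+6\rho^2(1-\rho)^2$.
   Context: $H(x)=-x\log_2x-(1-x)\log_2(1-x)$ is the binary entropy function. A linear code $C\le\mathbb{F}_2^n$ has parity-check density at most $w$ if its dual code $C^\perp$ is spanned by vectors of Hamming weight at most $w$. For $0<\delta<1/2$, $R_w(\delta)$ denotes the largest asymptotically achievable rate of binary linear codes with parity-check density at most $w$ and relative minimum distance at least $\delta$, i.e. $R_w(\delta)=\limsup_{n\to\infty}\max_C\frac1n\log_2|C|$, where the maximum is over linear codes $C\le\mathbb{F}_2^n$ of parity-check density at most $w$ and minimum Hamming distance at least $\delta n$. *)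

(* Defs.v *)
From HB Require Import structures.
From mathcomp Require Import all_boot all_order all_algebra.
From mathcomp Require Import all_classical all_reals all_analysis.
Set Implicit Arguments. Unset Strict Implicit. Unset Printing Implicit Defensive.
Import Order.TTheory GRing.Theory Num.Theory.
Local Open Scope ring_scope.

Definition hwt n (x : 'rV['F_2]_n) : nat := #|[set j : 'I_n | x 0 j != 0]|.

(* A binary linear code: contains 0 and closed under addition
   (over F_2 this is exactly being a subspace). *)
Definition is_linear_code n (C : {set 'rV['F_2]_n}) : Prop :=
  0 \in C /\ forall x y, x \in C -> y \in C -> x + y \in C.

Definition dual_code n (C : {set 'rV['F_2]_n}) : {set 'rV['F_2]_n} :=
  [set y | [forall x in C, x *m y^T == 0]].

Definition pc_density_le n (w : nat) (C : {set 'rV['F_2]_n}) : Prop :=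
  exists m (P : 'M['F_2]_(m, n)),
    (forall i, (hwt (row i P) <= w)%N) /\
    dual_code C = [set y | (y <= P)%MS].

(* Minimum distance at least d (vacuous for the zero code). *)
Definition min_dist_ge n (C : {set 'rV['F_2]_n}) (d : nat) : Prop :=
  forall x, x \in C -> x != 0 -> (d <= hwt x)%N.

Section Reals.
Variable R : realType.

Definition log2 (x : R) : R := ln x / ln 2.
Definition log4 (x : R) : R := ln x / ln 4.

Definition H2 (x : R) : R := - x * log2 x - (1 - x) * log2 (1 - x).

Definition H4 (x : R) : R := x * log4 3 - x * log4 x - (1 - x) * log4 (1 - x).

Definition admissible (w : nat) (delta : R) n (C : {set 'rV['F_2]_n}) : Prop :=
  is_linear_code C /\ pc_density_le w C /\
  exists d : nat, (delta * n%:R <= d%:R) /\ min_dist_ge C d.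

Definition rate n (C : {set 'rV['F_2]_n}) : R := log2 (#|C|%:R) / n%:R.

(* max over admissible codes of length n of (1/n) log2 |C|; the zero code is
   always admissible (rate 0), and rates are >= 0, so 0 is a harmless
   default for the max. *)
Definition best_rate (w : nat) (delta : R) (n : nat) : R :=
  \big[Num.max/0]_(C : {set 'rV['F_2]_n} | `[< admissible w delta C >]) rate C.

Definition Rw (w : nat) (delta : R) : \bar R :=
  limn_esup (fun n => (best_rate w delta n)%:E).

Definition Fpoly (r : R) : R :=
  (1 - r) ^+ 4 + 4 * r * (1 - r) ^+ 3 + 6 * r ^+ 2 * (1 - r) ^+ 2.

End Reals.

(* Main.v *)
Require Import Defs.
From HB Require Import structures.
From mathcomp Require Import all_boot all_order all_algebra.
From mathcomp Require Import all_classical all_reals all_analysis.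
From mathcomp Require Import ring lra.
Import Order.TTheory GRing.Theory Num.Theory.
Local Open Scope ring_scope.

(* Fold the cube along the dual code V of C.  The eigenvalues of the folded graph are n - 2 |c|
   for c in C, so a nonnegative function f on a Hamming ball of radius about rho n with
   A f >= ((1 - 2 delta) n + 1) f cannot be folded into less than a 1/n fraction of the
   cosets of V: up to a factor n, |C| is at most the number of cosets of V that meet the ball.
   That number is at most tau^(- rho n) times the sum over the cosets of V of the maximum of
   tau^|x|, for any 0 < tau <= 1.  Build V up one parity check at a time, starting from {0}
   and no coordinates.  A check with s new coordinates merges pairs of cosets whose old maxima
   p, q satisfy tau^(w - s) <= p / q <= tau^(s - w), and the merged maxima are
   max(tau^k p, tau^(s - k) q); this multiplies the sum by at most a^s for a suitable
   a = a(w, tau).  As all coordinates are covered, |C| <= n tau^(- rho n) a^n up to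
   exp(o(n)); the three bounds are three choices of tau and a. *)

(** * Characters of the cube *)

Section Fourier.
Context {R : realType} {n : nat}.
Implicit Types (x y z : 'rV['F_2]_n) (C V : {set 'rV['F_2]_n}).

Lemma F2_cases (b : 'F_2) : b = 0 \/ b = 1.
Proof. by case: b => -[|[|//]] i; [left|right]; apply/val_inj. Qed.

Lemma rVF2_addxx x : x + x = 0.
Proof.
by apply/rowP => j; rewrite !mxE; case: (F2_cases (x 0 j)) => ->; apply/val_inj.
Qed.

Lemma rVF2_oppr x : - x = x.
Proof. by apply/eqP; rewrite eq_sym -addr_eq0 rVF2_addxx. Qed.

Lemma rVF2_addxK x : cancel (fun y => y + x) (fun y => y + x).
Proof. by move=> y; rewrite -addrA rVF2_addxx addr0. Qed.

Lemma card_rVF2 : #|{: 'rV['F_2]_n}| = (2 ^ n)%N.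
Proof. by rewrite card_mx card_Fp // mul1n. Qed.

Lemma reindex_addr z (f : 'rV['F_2]_n -> R) : \sum_x f x = \sum_x f (x + z).
Proof.
by apply: reindex; exists (fun x => x + z) => x _; rewrite rVF2_addxK.
Qed.

Definition chi x y : R := (-1) ^+ ((x *m y^T) 0 0 != 0).

Lemma chiDl x y z : chi (x + y) z = chi x z * chi y z.
Proof.
rewrite /chi mulmxDl [X in X != 0]mxE.
case: (F2_cases ((x *m z^T) 0 0)) => ->; case: (F2_cases ((y *m z^T) 0 0)) => ->;
 by rewrite /= ?expr0 ?expr1 ?mulr1 ?mul1r ?mulN1r ?opprK.
Qed.

Lemma chiC x y : chi x y = chi y x.
Proof.
rewrite /chi; suff -> : (x *m y^T) 0 0 = (y *m x^T) 0 0 by [].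
by rewrite !mxE; apply: eq_bigr => j _; rewrite !mxE mulrC.
Qed.

Lemma chiDr x y z : chi x (y + z) = chi x y * chi x z.
Proof. by rewrite chiC chiDl !(chiC x). Qed.

Lemma chi0 y : chi 0 y = 1.
Proof. by rewrite /chi mul0mx mxE eqxx. Qed.

Lemma chi_delta y j : chi (delta_mx 0 j) y = 1 - 2 * (y 0 j != 0)%:R.
Proof.
rewrite /chi -rowE !mxE; case: (y 0 j != 0); rewrite /= ?expr1 ?expr0; lra.
Qed.

(** Translating by [z] multiplies the sum by [chi z y], so the sum vanishes unless that factor is 1.
    Asking only for closure under one translation covers the whole cube and linear codes alike. *)
Lemma sum_chi_translation (V : {set 'rV['F_2]_n}) y z : z \in V ->
  {in V, forall x, x + z \in V} -> chi z y != 1 -> \sum_(x in V) chi x y = 0.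
Proof.
move=> zV Vz zy.
suff : chi z y * (\sum_(x in V) chi x y) = \sum_(x in V) chi x y.
  by move/eqP; rewrite -subr_eq0 -{2}[\sum_(x in V) _]mul1r -mulrBl mulf_eq0
       subr_eq0 (negPf zy) => /eqP.
rewrite mulr_sumr [RHS](reindex (fun x => x + z)).
  apply: eq_big => [x|x xV]; last by rewrite chiDl mulrC.
  by apply/idP/idP => [/Vz//|/Vz]; rewrite rVF2_addxK.
by exists (fun x => x + z) => x _; rewrite rVF2_addxK.
Qed.

Lemma sum_chi x : \sum_y chi x y = (2 ^ n * (x == 0))%:R.
Proof.
have [->|x0] := eqVneq x 0.
  under eq_bigr do rewrite chi0.
  by rewrite sumr_const card_rVF2 muln1.
have [j xj] : exists j, x 0 j != 0.
  apply/existsP; apply: contraNT x0; rewrite negb_exists => /forallP x0.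
  by apply/eqP/rowP => j; rewrite mxE; apply/eqP; have := x0 j; rewrite negbK.
under eq_bigr do rewrite chiC.
rewrite muln0; transitivity (\sum_(y in [set: 'rV['F_2]_n]) chi y x).
  by apply: eq_bigl => y; rewrite inE.
apply: (@sum_chi_translation _ _ (delta_mx 0 j)) => [|y _|]; rewrite ?inE //.
by rewrite chi_delta xj; apply/eqP => /= ?; lra.
Qed.

Definition fourier (f : 'rV['F_2]_n -> R) y := \sum_x f x * chi x y.

Lemma parseval f g : \sum_y fourier f y * fourier g y = (2 ^ n)%:R * \sum_x f x * g x.
Proof.
transitivity (\sum_x \sum_x' f x * g x' * \sum_y chi (x + x') y).
  under eq_bigr do rewrite /fourier mulr_suml.
  rewrite exchange_big; apply: eq_bigr => x _ /=.
  under eq_bigr do rewrite mulr_sumr.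
  rewrite exchange_big; apply: eq_bigr => x' _ /=.
  rewrite mulr_sumr; apply: eq_bigr => y _; rewrite chiDl; ring.
rewrite mulr_sumr; apply: eq_bigr => x _.
rewrite (bigD1 x) //= [X in _ + X]big1 ?addr0 => [|x' x'x]; rewrite sum_chi.
  by rewrite rVF2_addxx eqxx muln1 mulrC.
by rewrite addrC addr_eq0 rVF2_oppr (negPf x'x) muln0 mulr0.
Qed.

Lemma fourier0 f : fourier f 0 = \sum_x f x.
Proof. by apply: eq_bigr => x _; rewrite chiC chi0 mulr1. Qed.

(** The same translation trick; applied to all [z] in a dual code, it confines the transform of an
    invariant function to the code itself. *)
Lemma fourier_invariant f y z : (forall x, f (x + z) = f x) -> chi z y != 1 ->
  fourier f y = 0.
Proof.
move=> fz zy.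
suff : chi z y * fourier f y = fourier f y.
  by move/eqP; rewrite -subr_eq0 -{2}[fourier f y]mul1r -mulrBl mulf_eq0
       subr_eq0 (negPf zy) => /eqP.
rewrite {2}/fourier (reindex_addr z) /fourier mulr_sumr; apply: eq_bigr => x _.
rewrite fz chiDl; ring.
Qed.

Definition adj (f : 'rV['F_2]_n -> R) x := \sum_(j < n) f (x + delta_mx 0 j).

Lemma hwtE y : (hwt y)%:R = \sum_(j < n) (y 0 j != 0)%:R :> R.
Proof.
rewrite /hwt -sum1_card natr_sum big_mkcond /=; apply: eq_bigr => j _.
by rewrite inE; case: (y 0 j != 0).
Qed.

(** Characters are eigenfunctions of the cube's adjacency operator; the eigenvalue is the sum of
    [chi] over the unit vectors, to which each coordinate of [y] contributes 1 or -1. *)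
Lemma fourier_adj f y : fourier (adj f) y = (n%:R - 2 * (hwt y)%:R) * fourier f y.
Proof.
rewrite /fourier /adj; under eq_bigr do rewrite mulr_suml.
rewrite exchange_big /= hwtE [2 * _]mulr_sumr.
have -> : n%:R = \sum_(j < n) 1 :> R by rewrite sumr_const card_ord.
rewrite -sumrB mulr_suml.
apply: eq_bigr => j _; rewrite -chi_delta (reindex_addr (delta_mx 0 j)) mulr_sumr.
by apply: eq_bigr => x _; rewrite rVF2_addxK chiDl; ring.
Qed.

Lemma dual_codeP C y : reflect (forall x, x \in C -> chi x y = 1) (y \in dual_code C).
Proof.
rewrite inE; apply: (iffP (forall_inP)) => H x xC.
  by rewrite /chi (eqP (H x xC)) mxE eqxx.
apply/eqP/rowP => i; rewrite !ord1 [RHS]mxE; apply/eqP.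
have := H x xC; rewrite /chi; case: eqP => //= _ /eqP; rewrite expr1 => /eqP; lra.
Qed.

Lemma sum_chi_code C y : is_linear_code C ->
  \sum_(x in C) chi x y = #|C|%:R * (y \in dual_code C)%:R.
Proof.
move=> [C0 CD]; case: dual_codeP => [H|H].
  by rewrite mulr1 (eq_bigr (fun=> 1)) ?sumr_const // => x /H.
rewrite mulr0; have [z zC zy] : exists2 z, z \in C & chi z y != 1.
  apply: contrapT => K; apply: H => x xC; apply/eqP; apply: contrapT => /negP xy.
  by apply: K; exists x.
by apply: (@sum_chi_translation _ _ z) => // x xC; apply: CD.
Qed.

(** Sum [chi c y * chi x y] over [c] in [C] and all [y] in both orders: summing over [c] first
    leaves the dual code, summing over [y] first leaves only [c = x]. Both the size of the dual code
    and the double dual follow. *)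
Lemma sum_chi_dual C x : is_linear_code C ->
  #|C|%:R * \sum_(y in dual_code C) chi x y = (2 ^ n * (x \in C))%:R.
Proof.
move=> lC.
transitivity (\sum_y (\sum_(c in C) chi c y) * chi x y).
  rewrite mulr_sumr big_mkcond; apply: eq_bigr => y _; rewrite sum_chi_code //.
  by case: (y \in dual_code C); rewrite ?mulr1 ?mulr0 ?mul0r.
under eq_bigr do rewrite mulr_suml.
rewrite exchange_big /=.
under eq_bigr => c _ do (under eq_bigr do rewrite -chiDl); under eq_bigr do rewrite sum_chi.
case: (boolP (x \in C)) => xC.
  rewrite (bigD1 x) //= big1 ?addr0 ?rVF2_addxx ?eqxx // => c /andP[_ cx].
  by rewrite addr_eq0 rVF2_oppr (negPf cx) muln0.
rewrite big1 ?muln0 // => c cC; rewrite addr_eq0 rVF2_oppr.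
by case: eqP cC xC => [->->//|]; rewrite muln0.
Qed.

Lemma dual_code0 C : 0 \in dual_code C.
Proof. by apply/dual_codeP => x _; rewrite chiC chi0. Qed.

Lemma dual_codeD C y z : y \in dual_code C -> z \in dual_code C -> y + z \in dual_code C.
Proof.
by move=> /dual_codeP H /dual_codeP K; apply/dual_codeP => x xC; rewrite chiDr H ?K ?mulr1.
Qed.

Lemma card_dual_code C : is_linear_code C -> (#|C| * #|dual_code C|)%N = (2 ^ n)%N.
Proof.
move=> lC; have := sum_chi_dual C 0 lC; rewrite lC.1 muln1.
under eq_bigr do rewrite chi0.
by rewrite sumr_const -natrM => /eqP; rewrite eqr_nat => /eqP.
Qed.

Lemma dual_dual_code C x : is_linear_code C ->
  (forall y, y \in dual_code C -> chi y x = 1) -> x \in C.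
Proof.
move=> lC H; have := sum_chi_dual C x lC.
under eq_bigr => y yC do rewrite chiC H //.
rewrite sumr_const -natrM (card_dual_code _ lC); case: (x \in C) => // /eqP.
by rewrite eqr_nat muln0 expn_eq0.
Qed.

End Fourier.

(** * The covering argument *)

Section Covering.
Context {R : realType}.

Lemma cauchy_schwarz_supp (T : finType) (S : {set T}) (F : T -> R) :
  (forall x, x \notin S -> F x = 0) ->
  (\sum_x F x) ^+ 2 <= #|S|%:R * \sum_x F x ^+ 2.
Proof.
move=> FS.
have E (G : T -> R) : (forall x, x \notin S -> G x = 0) -> \sum_x G x = \sum_(x in S) G x.
  move=> GS; rewrite (bigID (mem S)) /= [X in _ + X]big1 ?addr0 //.
rewrite !E //; last by move=> x /FS ->; rewrite expr0n.
have [->|S0] := eqVneq S finset.set0; first by rewrite !big_set0 expr0n mulr0.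
set t := \sum_(x in S) F x; set q := \sum_(x in S) _.
have s0 : 0 < #|S|%:R :> R by rewrite ltr0n card_gt0.
have : 0 <= \sum_(x in S) (F x - t / #|S|%:R) ^+ 2 by apply: sumr_ge0 => x _; apply: sqr_ge0.
under eq_bigr do rewrite sqrrB.
rewrite big_split /= sumrB sumr_const sumrMnl -mulr_suml -/t -/q -[X in _ + X]mulr_natl.
move=> /(mulr_ge0 (ltW s0)).
suff -> : #|S|%:R * (q - t * (t / #|S|%:R) *+ 2 + #|S|%:R * (t / #|S|%:R) ^+ 2) =
   #|S|%:R * q - t ^+ 2 by rewrite subr_ge0.
by field; rewrite gt_eqF.
Qed.

Section Code.
Context {n : nat}.
Implicit Types (x y z : 'rV['F_2]_n) (C V : {set 'rV['F_2]_n}).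

(** Fold [f] to the sum [F] of its translates by the dual code. The transform of [F] lives on [C],
    whose nonzero words have adjacency eigenvalue at most n - 2D. Comparing this spectral bound with
    [lam * F <= adj F] forces the mean of [F] to be large, and Cauchy-Schwarz turns that into a
    large support. *)
Lemma covering_fraction C (f : 'rV['F_2]_n -> R) (lam D : R) :
  is_linear_code C -> (forall x, x \in C -> x != 0 -> D <= (hwt x)%:R) -> 0 <= D ->
  (forall x, 0 <= f x) -> (exists x, 0 < f x) -> (forall x, lam * f x <= adj f x) ->
  (lam - n%:R + 2 * D) * (2 ^ n)%:R <=
    2 * D * #|[set x | [exists z in dual_code C, f (x + z) != 0]]|%:R.
Proof.
move=> lC CD D0 f0 [x0 fx0] flam; set V := dual_code C; set S := [set x | _].
pose F x := \sum_(z in V) f (x + z).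
have F0 x : 0 <= F x by apply: sumr_ge0.
have FV z : z \in V -> forall x, F (x + z) = F x.
  move=> zV x; rewrite /F [RHS](reindex (fun y => y + z)); last first.
    by exists (fun y => y + z) => y _; rewrite rVF2_addxK.
  apply: eq_big => [y|y yV]; last by rewrite -addrA (addrC z).
  apply/idP/idP => [yV|yzV]; first exact: dual_codeD.
  by rewrite -(rVF2_addxK z y); apply: dual_codeD.
have FS x : x \notin S -> F x = 0.
  rewrite inE negb_exists => /forallP H; apply: big1 => z zV.
  by have := H z; rewrite zV /= negbK => /eqP.
have Flam x : lam * F x <= adj F x.
  rewrite /F /adj exchange_big mulr_sumr; apply: ler_sum => z _ /=.
  apply: le_trans (flam _) _; rewrite /adj le_eqVlt; apply/orP; left; apply/eqP.
  by apply: eq_bigr => j _; rewrite addrAC.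
pose Q := \sum_x F x ^+ 2; pose T := \sum_x F x.
have Q0 : 0 < Q.
  rewrite /Q (bigD1 x0) //= ltr_wpDr ?sumr_ge0 // => [x _|]; first exact: sqr_ge0.
  rewrite exprn_gt0 // /F (bigD1 0) ?dual_code0 //= addr0 ltr_wpDr // sumr_ge0 //.
have QF : \sum_y fourier F y ^+ 2 = (2 ^ n)%:R * Q by rewrite -(parseval F F).
have H1 : (2 ^ n)%:R * (lam * Q) <= \sum_y fourier F y * fourier (adj F) y.
  rewrite parseval ler_wpM2l ?ler0n // mulr_sumr ler_sum // => x _.
  by rewrite expr2 mulrCA ler_wpM2l.
have H2 : \sum_y fourier F y * fourier (adj F) y <=
    2 * D * T ^+ 2 + (n%:R - 2 * D) * ((2 ^ n)%:R * Q).
  (* At frequency 0 the eigenvalue is n; its excess over n - 2D is the term 2D T^2. *)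
  rewrite -QF mulr_sumr (bigD1 0) //= [in leRHS](bigD1 0) //= addrA lerD //.
    rewrite !fourier_adj !fourier0 -/T.
    have -> : hwt (0 : 'rV['F_2]_n) = 0%N.
      by rewrite /hwt; apply: eq_card0 => j; rewrite inE mxE eqxx.
    by rewrite le_eqVlt; apply/orP; left; apply/eqP; ring.
  apply: ler_sum => y y0; rewrite fourier_adj mulrCA -expr2.
  have [->|Fy] := eqVneq (fourier F y) 0; first by rewrite expr0n /= !mulr0.
  rewrite ler_wpM2r ?sqr_ge0 //.
  have := CD y; suff -> : y \in C by move=> /(_ isT y0); lra.
  apply: (@dual_dual_code R) => // z zV; apply/eqP; apply: contraNT Fy => zy.
  by rewrite (fourier_invariant _ _ z) ?eqxx // => x; apply: FV.
have H3 : T ^+ 2 <= #|S|%:R * Q by exact: cauchy_schwarz_supp.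
have H4 : 2 * D * T ^+ 2 <= 2 * D * (#|S|%:R * Q) by rewrite ler_wpM2l // mulr_ge0.
rewrite -(ler_pM2r Q0); nra.
Qed.

Definition supp x : {set 'I_n} := [set j | x 0 j != 0].

Lemma suppD x y : supp (x + y) = (supp x :\: supp y) :|: (supp y :\: supp x).
Proof.
apply/setP => j; rewrite !inE mxE.
by case: (F2_cases (x 0 j)) => ->; case: (F2_cases (y 0 j)) => ->.
Qed.

Lemma supp_delta j : supp (delta_mx 0 j) = [set j].
Proof. by apply/setP => i; rewrite !inE mxE /=; case: (i == j). Qed.

Lemma hwtD_delta x j :
  hwt (x + delta_mx 0 j) = if j \in supp x then (hwt x).-1 else (hwt x).+1.
Proof.
rewrite /hwt -/(supp _) -/(supp x) suppD supp_delta; case: ifP => jx.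
  have /eqP -> : [set j] :\: supp x == finset.set0 by rewrite finset.setD_eq0 finset.sub1set.
  by rewrite finset.setU0 [in RHS](cardsD1 j) jx.
have xj : x 0 j = 0 by apply/eqP; move: jx; rewrite inE => /negbFE.
have -> : supp x :\ j = supp x.
  by apply/setP => i; rewrite !inE; have [->|] := eqVneq i j; rewrite ?xj ?eqxx.
have -> : [set j] :\: supp x = [set j].
  by apply/setP => i; rewrite !inE; have [->|] := eqVneq i j; rewrite ?andbF ?xj ?eqxx.
by rewrite finset.setUC cardsU1 jx.
Qed.

(** At weight 0 the truncated predecessor does no harm, as its coefficient is 0. *)
Lemma adj_radial (g : nat -> R) x : adj (fun y => g (hwt y)) x =
  (hwt x)%:R * g (hwt x).-1 + (n%:R - (hwt x)%:R) * g (hwt x).+1.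
Proof.
rewrite /adj (bigID (mem (supp x))) /=.
congr (_ + _).
  under eq_bigr => j jx do rewrite hwtD_delta jx.
  by rewrite sumr_const mulr_natl.
under eq_bigr => j jx do rewrite hwtD_delta (negPf jx).
rewrite sumr_const -[LHS]mulr_natl; congr (_ * _).
have /(congr1 (fun k => k%:R : R)) := cardC (mem (supp x)).
rewrite card_ord natrD => <-; rewrite [_ + #|_|%:R]addrC addrK; congr (_ %:R).
Qed.

End Code.

(* [g k = theta ^ k (k - a) (r + 1 - k)] on a window [a < k <= r] just above [rho n]: the
   geometric factor makes [k / theta] and [(n - k) theta] both about
   [n sqrt (rho (1 - rho)) = n (1 / 2 - delta)], and a long parabola is almost invariant
   under averaging over neighbours. *)
Lemma radial_profile (delta sigma : R) : 0 < delta -> delta < 1 / 2 ->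
  1 / 2 - Num.sqrt (delta * (1 - delta)) < sigma ->
  exists N : nat, forall n : nat, (N <= n)%N ->
  exists (r : nat) (g : nat -> R), [/\ r%:R <= sigma * n%:R, forall k, 0 <= g k,
    forall k, (r < k)%N -> g k = 0, exists2 k, (k <= n)%N & 0 < g k &
    forall k, (k <= n)%N -> ((1 - 2 * delta) * n%:R + 1) * g k <=
      k%:R * g k.-1 + (n%:R - k%:R) * g k.+1].
Proof.
move=> d0 d1; set s := Num.sqrt _ => rs.
have ss : s ^+ 2 = delta * (1 - delta) by rewrite sqr_sqrtr //; nra.
have s0 : 0 < s by rewrite sqrtr_gt0; nra.
have s1 : s < 1 / 2 by rewrite -(@ltr_pXn2r _ 2%N) ?nnegrE ?ss //; nra.
(* [alpha] and [beta] will bound the window divided by n. Keeping [alpha] between 1/2 - s and 1/2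
   makes both factors of [gam] = s^2 - (1/2 - alpha)^2 positive. *)
have [alpha [al1 al2 al3]] :
    exists alpha : R, [/\ 1 / 2 - s < alpha, alpha < sigma & alpha < 1 / 2].
  exists ((1 / 2 - s + Num.min sigma (1 / 2)) / 2).
  have : 1 / 2 - s < Num.min sigma (1 / 2) by rewrite lt_min rs; lra.
  by case: (leP sigma (1 / 2)) => ? ?; split; lra.
pose gam := alpha * (1 - alpha) - (1 / 2 - delta) ^+ 2.
have gam0 : 0 < gam.
  have -> : gam = s ^+ 2 - (1 / 2 - alpha) ^+ 2 by rewrite ss /gam; field.
  by rewrite subr_sqr; apply: mulr_gt0; lra.
(* The cap alpha + gam keeps alpha (1 - beta) above (1/2 - delta)^2, whence kap > 0 below. *)
have [beta [be1 be2 be3]] : exists beta, [/\ alpha < beta, beta <= sigma & beta <= alpha + gam].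
  exists (Num.min sigma (alpha + gam)); split.
  - by rewrite lt_min al2; lra.
  - by rewrite ge_min lexx.
  - by rewrite ge_min lexx orbT.
have be4 : beta < 1 by rewrite /gam in be3; nra.
pose mu := Num.sqrt (alpha * (1 - beta)).
have mu2 : mu ^+ 2 = alpha * (1 - beta) by rewrite sqr_sqrtr //; nra.
pose kap := mu - (1 / 2 - delta).
have kap0 : 0 < kap.
  rewrite subr_gt0 -(@ltr_pXn2r _ 2%N) ?nnegrE ?sqrtr_ge0 ?mu2 //; last lra.
  by rewrite /gam in be3 gam0; nra.
have mu0 : 0 < mu by rewrite /kap in kap0; lra.
pose theta := mu / (1 - beta).
have th0 : 0 < theta by rewrite divr_gt0 // subr_gt0.
have th1 : alpha / theta = mu.
  rewrite /theta; apply: (@mulIf _ (mu)); first by rewrite gt_eqF.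
  rewrite -expr2 mu2; field; rewrite !gt_eqF //; lra.
have th2 : (1 - beta) * theta = mu by rewrite /theta; field; rewrite gt_eqF //; lra.
(* The first term lets kap n absorb the summand 1 of the eigenvalue; the second makes the window
   longer than 2 mu / kap, so that the curvature of the parabola is absorbed too. *)
pose N := Num.max (1 / kap) ((1 + 2 * mu / kap) / (beta - alpha)).
exists (Num.truncn N).+1 => n nN.
have {nN}nN : N <= n%:R.
  by apply: ltW; apply: lt_le_trans (truncnS_gt _) _; rewrite ler_nat.
have n1 : 1 <= kap * n%:R.
  rewrite mulrC -ler_pdivrMr //; apply: le_trans nN.
  by rewrite /N le_max lexx.
have n2 : 1 + 2 * mu / kap <= (beta - alpha) * n%:R.
  rewrite [leRHS]mulrC -ler_pdivrMr ?subr_gt0 //; apply: le_trans nN.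
  by rewrite /N le_max lexx orbT.
have n0 : 0 < n%:R :> R by nra.
pose a := Num.truncn (alpha * n%:R); pose r := Num.truncn (beta * n%:R).
have an0 : 0 <= alpha * n%:R by rewrite mulr_ge0 // ?ler0n //; lra.
have bn0 : 0 <= beta * n%:R by rewrite mulr_ge0 // ?ler0n //; lra.
have a1 : a%:R <= alpha * n%:R by rewrite /a truncn_le.
have a2 : alpha * n%:R < a%:R + 1 by rewrite natr1 truncnS_gt.
have r1 : r%:R <= beta * n%:R by rewrite /r truncn_le.
have r2 : beta * n%:R < r%:R + 1 by rewrite natr1 truncnS_gt.
have mk0 : 0 < 2 * mu / kap by rewrite divr_gt0 // mulr_gt0.
have rn : (r <= n)%N by rewrite -(ler_nat R); nra.
have M0 : 2 * mu / kap <= r%:R - a%:R by lra.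
have ar : (a < r)%N by rewrite -(ltr_nat R); lra.
pose h (k : nat) : R := if (a < k <= r)%N then (k%:R - a%:R) * (r%:R + 1 - k%:R) else 0.
have hge0 k : 0 <= h k.
  rewrite /h; case: ifP => // /andP[ak kr].
  by rewrite mulr_ge0 // subr_ge0 ?ler_nat ?(ltnW ak) // natr1 ler_nat ltnW.
exists r, (fun k => theta ^+ k * h k); split.
- by apply: le_trans r1 _; rewrite ler_wpM2r.
- by move=> k; rewrite mulr_ge0 // exprn_ge0 // ltW.
- by move=> k rk; rewrite /h [(k <= r)%N]leqNgt rk andbF mulr0.
- exists r => //; rewrite mulr_gt0 ?exprn_gt0 // /h ar leqnn /=.
  by rewrite mulr_gt0 // ?subr_gt0 ?ltr_nat //; lra.
move=> k kn.
case: (boolP (a < k <= r)%N) => [/andP[ak kr]|akr]; last first.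
  rewrite {1}/h (negPf akr) !mulr0 addr_ge0 // mulr_ge0 ?mulr_ge0 ?exprn_ge0 ?(ltW th0) //.
  by rewrite subr_ge0 ler_nat.
case: k ak kr kn => // k ak kr kn /=.
have akR : a%:R <= k%:R :> R by rewrite ler_nat -ltnS.
have krR : k%:R + 1 <= r%:R :> R by rewrite natr1 ler_nat.
(* The parabola vanishes at a and at r + 1, so its formula also holds for the neighbours just
   outside the window. *)
have h1 : h k = (k%:R - a%:R) * (r%:R + 1 - k%:R).
  rewrite /h; rewrite (ltnW kr) andbT; case: ifP => // /negbT; rewrite -leqNgt => ka.
  have -> : k = a by apply/eqP; rewrite eqn_leq ka -ltnS.
  by rewrite subrr mul0r.
have h2 : h k.+2 = (k%:R + 2 - a%:R) * (r%:R + 1 - (k%:R + 2)).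
  have e : k.+2%:R = k%:R + 2 :> R by rewrite -natrD addn2.
  rewrite /h e (leqW ak) /=; case: ifP => // /negbT; rewrite -ltnNge ltnS => rk.
  have -> : r = k.+1 by apply/eqP; rewrite eqn_leq kr andbT.
  by rewrite -(natr1 k); ring.
have h3 : h k.+1 = (k%:R + 1 - a%:R) * (r%:R - k%:R).
  by rewrite /h ak kr -(natr1 k) /=; ring.
(* Two factors that are at least 1 and add up to r - a + 1 have product at least r - a. *)
have H : r%:R - a%:R <= h k.+1 by rewrite h3; nra.
have H' : h k + h k.+2 = 2 * h k.+1 - 2 by rewrite h1 h2 h3; ring.
have kA : n%:R * mu <= k.+1%:R / theta.
  rewrite -th1 mulrA ler_pM2r ?invr_gt0 // -(natr1 k); lra.
have kB : n%:R * mu <= (n%:R - k.+1%:R) * theta.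
  rewrite -th2 mulrA ler_pM2r // -(natr1 k); nra.
have -> : k.+1%:R * (theta ^+ k * h k) + (n%:R - k.+1%:R) * (theta ^+ k.+2 * h k.+2) =
   theta ^+ k.+1 * (k.+1%:R / theta * h k + (n%:R - k.+1%:R) * theta * h k.+2).
  by rewrite !exprS; field; rewrite gt_eqF.
rewrite mulrCA ler_pM2l ?exprn_gt0 //.
have K1 := ler_wpM2r (hge0 k) kA.
have K2 := ler_wpM2r (hge0 k.+2) kB.
apply: le_trans (lerD K1 K2); rewrite -mulrDr H'.
have K3 : kap * n%:R * h k.+1 <= (2 * kap * n%:R - 1) * h k.+1 by rewrite ler_wpM2r //; lra.
have K4 : 2 * mu <= kap * h k.+1.
  by rewrite mulrC [kap * _]mulrC -ler_pdivrMr // (le_trans _ H) // mulrC.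
have K5 : 2 * mu * n%:R <= kap * n%:R * h k.+1 by nra.
rewrite /kap in K3 K4 K5; lra.
Qed.

End Covering.

(** * Coset maxima *)

Section CosetMaximum.
Context {R : realType} {n : nat}.
Implicit Types (x y z u e : 'rV['F_2]_n) (C V : {set 'rV['F_2]_n}) (A S T : {set 'I_n}).

Definition ind A : 'rV['F_2]_n := \row_j (j \in A)%:R.

Lemma supp_ind A : supp (ind A) = A.
Proof. by apply/setP => j; rewrite !inE mxE; case: (j \in A). Qed.

Lemma supp_inj : injective (@supp n).
Proof.
move=> x y /setP xy; apply/rowP => j; have := xy j; rewrite !inE.
by case: (F2_cases (x 0 j)) => ->; case: (F2_cases (y 0 j)) => ->.
Qed.

Lemma suppD_disjoint x y : [disjoint supp x & supp y] -> supp (x + y) = supp x :|: supp y.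
Proof.
move=> xy; rewrite suppD; apply/setP => j; rewrite !inE.
have := disjointFr xy (x := j); rewrite !inE.
by case: (x 0 j != 0) => [/(_ isT)|_]; rewrite ?andbF ?andbT ?orbF // => ->.
Qed.

Lemma hwtD_disjoint x y : [disjoint supp x & supp y] -> hwt (x + y) = (hwt x + hwt y)%N.
Proof.
move=> xy; rewrite /hwt -/(supp _) -/(supp x) -/(supp y) suppD_disjoint // cardsU.
by move: xy; rewrite -setI_eq0 => /eqP ->; rewrite cards0 subn0.
Qed.

Lemma hwt_ind A : hwt (ind A) = #|A|.
Proof. by rewrite /hwt -/(supp _) supp_ind. Qed.

Lemma suppD_sub x y S : supp x \subset S -> supp y \subset S -> supp (x + y) \subset S.
Proof.
move=> xS yS; rewrite suppD; apply/fintype.subsetP => j; rewrite !inE.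
by case/orP => /andP[_ H]; [apply: (fintype.subsetP xS)|apply: (fintype.subsetP yS)];
  rewrite inE.
Qed.

Lemma hwtD_le x y : (hwt (x + y) <= hwt x + hwt y)%N.
Proof.
rewrite /hwt -/(supp _) -/(supp x) -/(supp y) suppD.
by apply: leq_trans (leq_card_setU _ _) _; rewrite leq_add // subset_leq_card // subsetDl.
Qed.

(** Each vector splits uniquely into a part off [T] and the indicator of its support inside [T]. *)
Lemma sum_fibers T (G : 'rV['F_2]_n -> R) :
  \sum_x G x = \sum_(u | [disjoint supp u & T]) \sum_(A : {set 'I_n} | A \subset T) G (u + ind A).
Proof.
pose pr x := x + ind (supp x :&: T).
have prE x : supp (pr x) = supp x :\: T.
  rewrite /pr suppD supp_ind; apply/setP => j; rewrite !inE.
  by case: (x 0 j != 0); case: (j \in T).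
rewrite (partition_big pr (fun u => [disjoint supp u & T])) /=; last first.
  move=> x _; rewrite prE -setI_eq0; apply/eqP/setP => j; rewrite !inE.
  by case: (j \in T); rewrite ?andbF.
apply: eq_bigr => u uT.
rewrite (reindex_onto (fun A => u + ind A) (fun x => supp x :&: T)) /=; last first.
  by move=> x /eqP <-; rewrite /pr rVF2_addxK.
apply: eq_bigl => A.
apply/andP/idP => [[_ /eqP <-]|AT]; first exact: subsetIr.
have uA : supp (u + ind A) = supp u :|: A.
  by rewrite suppD_disjoint supp_ind //; apply: disjointWr uT.
have uAT : supp (u + ind A) :&: T = A.
  rewrite uA finset.setIUl; move: (uT); rewrite -setI_eq0 => /eqP ->.
  by rewrite finset.set0U; apply/finset.setIidPl.
by rewrite /pr uAT rVF2_addxK !eqxx.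
Qed.

Lemma sum_subsets_card (K : finType) (T : {set K}) (psi : nat -> R) :
  \sum_(A : {set K} | A \subset T) psi #|A| = \sum_(k < #|T|.+1) 'C(#|T|, k)%:R * psi k.
Proof.
transitivity (\sum_(k < #|T|.+1) \sum_(A : {set K} | (A \subset T) && (#|A| == k)) psi #|A|).
  rewrite (partition_big (fun A : {set K} => inord #|A| : 'I_#|T|.+1) predT) //=.
  apply: eq_bigr => k _; apply: eq_bigl => A; case: (boolP (A \subset T)) => //= AT.
  by rewrite -val_eqE /= inordK // ltnS subset_leq_card.
apply: eq_bigr => k _; rewrite (eq_bigr (fun=> psi k)); last by move=> A /andP[_ /eqP ->].
rewrite sumr_const mulr_natl; congr (_ *+ _).
by rewrite -(cards_draws T k) cardsE.
Qed.

Variable tau : R.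
Hypotheses (tau0 : 0 < tau) (tau1 : tau <= 1).

(** For nonempty [V] this is tau to the minimum weight in the coset x + V. Sums over all [x], rather
    than over cosets, count every coset of a linear [V] exactly |V| times. *)
Definition coset_max V x : R := \big[Num.max/0]_(z in V) tau ^+ hwt (x + z).

Lemma coset_max_ge V x z : z \in V -> tau ^+ hwt (x + z) <= coset_max V x.
Proof. by move=> zV; rewrite /coset_max; apply: le_bigmax_cond. Qed.

Lemma coset_max_le V x c : 0 <= c -> (forall z, z \in V -> tau ^+ hwt (x + z) <= c) ->
  coset_max V x <= c.
Proof. by move=> c0 H; rewrite /coset_max; apply: bigmax_le. Qed.

Lemma coset_max_ge0 V x : 0 <= coset_max V x.
Proof. exact: bigmax_ge_id. Qed.

(** Adding [e] raises weights by at most [k]. This supplies the ratio hypotheses of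
    [block_bound]. *)
Lemma coset_max_lip V x e k : (hwt e <= k)%N ->
  tau ^+ k * coset_max V x <= coset_max V (x + e).
Proof.
move=> ek; rewrite mulrC -ler_pdivlMr ?exprn_gt0 //.
apply: coset_max_le => [|z zV].
  by rewrite divr_ge0 ?coset_max_ge0 // exprn_ge0 // ltW.
rewrite ler_pdivlMr ?exprn_gt0 // -exprD.
apply: le_trans (coset_max_ge _ _ _ zV); apply: ler_wiXn2l => //; first exact: ltW.
rewrite addrAC; apply: leq_trans (hwtD_le _ _) _; exact: leq_add.
Qed.

(** No element of [V] can cancel coordinates outside [S], so those in [A] cost their full weight. *)
Lemma coset_max_off V S u A : (forall z, z \in V -> supp z \subset S) ->
  [disjoint S & A] -> [disjoint supp u & A] ->
  coset_max V (u + ind A) = tau ^+ #|A| * coset_max V u.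
Proof.
move=> VS SA uA.
have E z : z \in V -> tau ^+ hwt (u + ind A + z) = tau ^+ #|A| * tau ^+ hwt (u + z).
  move=> zV; rewrite addrAC (hwtD_disjoint (u + z)); first by rewrite hwt_ind exprD mulrC.
  rewrite supp_ind.
  rewrite suppD -setI_eq0 -finset.subset0; apply/fintype.subsetP => j; rewrite !inE.
  case/andP => /orP[]/andP[_ H] jA.
    by have := disjointFl uA jA; rewrite inE H.
  have := disjointFl SA jA; suff -> : j \in S by [].
  by apply: (fintype.subsetP (VS z zV)); rewrite inE.
have tA : 0 < tau ^+ #|A| by rewrite exprn_gt0.
apply/eqP; rewrite eq_le; apply/andP; split.
  apply: coset_max_le => [|z zV]; first by rewrite mulr_ge0 ?coset_max_ge0 // ltW.
  by rewrite E // ler_pM2l // coset_max_ge.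
rewrite mulrC -ler_pdivlMr //; apply: coset_max_le => [|z zV].
  by rewrite divr_ge0 ?coset_max_ge0 // ltW.
by rewrite ler_pdivlMr // mulrC -E // coset_max_ge.
Qed.

Lemma sum_coset_max_off V S T : (forall z, z \in V -> supp z \subset S) -> [disjoint S & T] ->
  \sum_x coset_max V x = (1 + tau) ^+ #|T| * \sum_(u | [disjoint supp u & T]) coset_max V u.
Proof.
move=> VS ST; rewrite (sum_fibers T) mulr_sumr; apply: eq_bigr => u uT.
transitivity ((\sum_(A : {set 'I_n} | A \subset T) tau ^+ #|A|) * coset_max V u).
  rewrite mulr_suml; apply: eq_bigr => A AT.
  by rewrite (coset_max_off _ S) //; apply: disjointWr AT _.
congr (_ * _); rewrite (sum_subsets_card _ _ (fun k => tau ^+ k)) exprDn.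
by apply: eq_bigr => k _; rewrite expr1n mul1r mulr_natl.
Qed.

(* [p] and [q] are the maxima over two cosets that differ by the old part of a check with [s] new
   coordinates; [k] counts the new coordinates of a vector of the first coset. *)
Definition block_bound (w : nat) (a : R) := forall (s : nat) (p q : R), (s <= w)%N ->
  0 <= p -> 0 <= q -> tau ^+ (w - s) * p <= q -> tau ^+ (w - s) * q <= p ->
  \sum_(k < s.+1) 'C(s, k)%:R * Num.max (tau ^+ k * p) (tau ^+ (s - k) * q) <= a ^+ s * (p + q).

Variables (w : nat) (a : R).
Hypotheses (a0 : 0 <= a) (wa : block_bound w a).

(** Write x = u + [ind A] with [A] inside the new coordinates [T] of [y], and let [e] be the old
    part of [y]. For fixed [u] the sum over [A] is the one in [block_bound], with p and q the maxima
    at u and u + e. The powers of 1 + tau on the left cancel the free contribution of [T] to the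
    right-hand sum. *)
Lemma sum_max_translate V S y : (forall z, z \in V -> supp z \subset S) -> (hwt y <= w)%N ->
  (1 + tau) ^+ #|supp y :\: S| * \sum_x Num.max (coset_max V x) (coset_max V (x + y)) <=
  2 * a ^+ #|supp y :\: S| * \sum_x coset_max V x.
Proof.
move=> VS yw; set T := supp y :\: S; set s := #|T|.
have ST : [disjoint S & T].
  by rewrite -setI_eq0; apply/eqP/setP => j; rewrite !inE; case: (j \in S).
rewrite (sum_coset_max_off _ _ _ VS ST) -/s mulrCA ler_wpM2l //.
  by rewrite exprn_ge0 // addr_ge0 // ltW.
pose e := y + ind T.
have suppe : supp e = supp y :\: T.
  rewrite suppD supp_ind; apply/setP => j; rewrite !inE.
  by case: (y 0 j != 0); case: (j \in S).
have eT : [disjoint supp e & T].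
  rewrite suppe -setI_eq0; apply/eqP/setP => j; rewrite !inE.
  by case: (y 0 j != 0); case: (j \in S).
have sy : (s <= hwt y)%N by apply: subset_leq_card; apply: subsetDl.
have ew : (hwt e <= w - s)%N.
  rewrite leq_subRL ?(leq_trans sy) // addnC -[s](hwt_ind T) -hwtD_disjoint ?supp_ind //.
  by rewrite /e rVF2_addxK.
have De u : [disjoint supp u & T] -> [disjoint supp (u + e) & T].
  move=> uT; rewrite suppD -setI_eq0 -finset.subset0; apply/fintype.subsetP => j.
  case/setIP => /setUP[]/setDP[H _] jT; first by rewrite (disjointFl uT jT) in H.
  by rewrite (disjointFl eT jT) in H.
(* Translation by [e] permutes the vectors off [T], so p and q have the same total: hence the factor
   2. *)
have -> : 2 * a ^+ s * \sum_(u | [disjoint supp u & T]) coset_max V u =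
   \sum_(u | [disjoint supp u & T]) a ^+ s * (coset_max V u + coset_max V (u + e)).
  rewrite -mulr_sumr big_split /= mulrC [2 * _]mulrC mulrCA; congr (_ * _).
  rewrite mulr_natr mulr2n; congr (_ + _); rewrite (reindex (fun u => u + e)) /=; last first.
    by exists (fun u => u + e) => u _; rewrite rVF2_addxK.
  apply: eq_bigl => u; apply/idP/idP => [/De|]; last exact: De.
  by rewrite rVF2_addxK.
rewrite (sum_fibers T); apply: ler_sum => u uT.
apply: le_trans (wa s (coset_max V u) (coset_max V (u + e)) _ _ _ _ _).
- rewrite -(sum_subsets_card _ T
    (fun k => Num.max (tau ^+ k * coset_max V u) (tau ^+ (s - k) * coset_max V (u + e)))).
  apply: ler_sum => A AT.
  rewrite (coset_max_off _ _ _ _ VS) ?(disjointWr AT) //.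
  (* Adding [y] complements [A] within [T], which produces the exponent s - k. *)
  have -> : u + ind A + y = (u + e) + ind (T :\: A).
    have -> : ind (T :\: A) = ind A + ind T.
      apply: supp_inj; rewrite suppD !supp_ind.
      by move: AT; rewrite -finset.setD_eq0 => /eqP ->; rewrite finset.set0U.
    by rewrite /e (addrC (ind A)) !addrA rVF2_addxK addrAC.
  rewrite (coset_max_off _ _ _ _ VS) ?(disjointWr (subsetDl T A)) ?De //.
  by rewrite cardsD (finset.setIidPr AT).
- exact: leq_trans yw.
- exact: coset_max_ge0.
- exact: coset_max_ge0.
- exact: coset_max_lip.
- by rewrite -{2}(rVF2_addxK e u); apply: coset_max_lip.
Qed.

Lemma coset_maxU V x y : coset_max (V :|: [set z + y | z in V]) x =
  Num.max (coset_max V x) (coset_max V (x + y)).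
Proof.
apply/eqP; rewrite eq_le; apply/andP; split.
  apply: coset_max_le => [|z]; first by rewrite le_max coset_max_ge0.
  rewrite inE le_max => /orP[zV|/imsetP[t tV ->]]; first by rewrite coset_max_ge.
  by rewrite [t + y]addrC addrA coset_max_ge ?orbT.
rewrite ge_max; apply/andP; split; apply: coset_max_le => [|z zV]; rewrite ?coset_max_ge0 //.
  by apply: coset_max_ge; rewrite inE zV.
by rewrite -addrA (addrC y); apply: coset_max_ge; rewrite inE [X in _ || X]imset_f ?orbT.
Qed.

(** Induction on the checks. The invariant says that each coset contributes on average at most a per
    covered and 1 + tau per uncovered coordinate; powers of 1 + tau stand on both sides to avoid the
    exponent n - |S|. A check already in [V] changes nothing; any other doubles |V|, matching the
    factor 2 of [sum_max_translate]. *)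
Lemma sum_coset_max_span (ys : seq 'rV['F_2]_n) : (forall y, y \in ys -> (hwt y <= w)%N) ->
  exists V S, [/\ is_linear_code V, forall y, y \in ys -> y \in V,
    forall C, is_linear_code C -> (forall y, y \in ys -> y \in C) -> V \subset C,
    forall j, j \in S -> exists2 y, y \in ys & j \in supp y &
    (1 + tau) ^+ #|S| * (\sum_x coset_max V x) <= #|V|%:R * a ^+ #|S| * (1 + tau) ^+ n
    /\ forall z, z \in V -> supp z \subset S].
Proof.
have supp0 : supp (0 : 'rV['F_2]_n) = finset.set0 by apply/setP => j; rewrite !inE mxE eqxx.
elim: ys => [_|y ys IH yw].
  exists [set 0], finset.set0; split=> //.
  - by split=> [|x y]; rewrite !inE // => /eqP -> /eqP ->; rewrite addr0.
  - by move=> C [C0 _] _; rewrite finset.sub1set.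
  - by move=> j; rewrite inE.
  have H z : z \in [set 0 : 'rV['F_2]_n] -> supp z \subset finset.set0.
    by rewrite inE => /eqP ->; rewrite supp0.
  split=> //.
  (* For V = {0} all coordinates are free and the sum of tau^|x| is (1 + tau)^n. *)
  rewrite cards0 cards1 !expr0 !mul1r (sum_coset_max_off _ finset.set0 [set: 'I_n]) //; last first.
    by rewrite -setI_eq0 finset.set0I.
  rewrite cardsT card_ord (big_pred1 0) => [|u]; last first.
    rewrite -setI_eq0 finset.setIT; apply/eqP/eqP => [u0|->//].
    by apply: supp_inj; rewrite supp0.
  rewrite -[leRHS]mulr1 ler_pM2l ?exprn_gt0 ?addr_gt0 //.
  by apply: coset_max_le => // z _; rewrite exprn_ile1 // ltW.
have [|V [S [[V0 VD] ysV Vmin SV [VM VS]]]] := IH.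
  by move=> z zys; apply: yw; rewrite inE zys orbT.
have {}yw : (hwt y <= w)%N by apply: yw; rewrite inE eqxx.
have [yV|yV] := boolP (y \in V).
  exists V, S; split=> //.
  - by move=> z; rewrite inE => /orP[/eqP ->|/ysV].
  - by move=> C lC H; apply: Vmin => // z zys; apply: H; rewrite inE zys orbT.
  - by move=> j /SV[z zys jz]; exists z => //; rewrite inE zys orbT.
exists (V :|: [set z + y | z in V]), (S :|: supp y); split.
- split=> [|u v]; rewrite !inE; first by rewrite V0.
  case/orP => [uV|/imsetP[u' uV ->]] /orP[vV|/imsetP[v' vV ->]].
  + by rewrite VD.
  + by rewrite addrA [X in _ || X]imset_f ?orbT // VD.
  + by rewrite addrAC [X in _ || X]imset_f ?orbT // VD.
  + by rewrite addrACA rVF2_addxx addr0 VD.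
- move=> z; rewrite !inE => /orP[/eqP ->|/ysV -> //].
  by apply/orP; right; apply/imsetP; exists 0; rewrite ?add0r.
- move=> C lC H; have VC : V \subset C.
    by apply: Vmin => // z zys; apply: H; rewrite inE zys orbT.
  rewrite finset.subUset VC /=; apply/fintype.subsetP => _ /imsetP[z zV ->].
  by apply: lC.2; [apply: (fintype.subsetP VC)|apply: H; rewrite inE eqxx].
- move=> j; rewrite inE => /orP[/SV[z zys jz]|jy]; last by exists y; rewrite // inE eqxx.
  by exists z => //; rewrite inE zys orbT.
split; last first.
  move=> z; rewrite inE => /orP[/VS zS|/imsetP[t /VS tS ->]].
    exact: fintype.subset_trans zS (finset.subsetUl _ _).
  apply: suppD_sub; last exact: finset.subsetUr.
  exact: fintype.subset_trans tS (finset.subsetUl _ _).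
have cV : #|V :|: [set z + y | z in V]| = (2 * #|V|)%N.
  rewrite cardsU card_imset; last by move=> u v /(can_inj (rVF2_addxK y)).
  suff -> : V :&: [set z + y | z in V] = finset.set0 by rewrite cards0 subn0 mul2n addnn.
  apply/setP => z; rewrite !inE; apply/negP => /andP[zV /imsetP[t tV zt]].
  by case/negP: yV; rewrite -[y](rVF2_addxK t) [y + t]addrC -zt; apply: VD.
have cS : #|S :|: supp y| = (#|S| + #|supp y :\: S|)%N.
  rewrite -[LHS](cardsID S) finset.setIUl finset.setIid; congr (_ + _)%N; apply: eq_card => j.
    by rewrite !inE; case: (j \in S); rewrite ?andbF ?andbT ?orbF.
  by rewrite !inE; case: (j \in S); rewrite ?andbF ?andbT ?orbF.
under eq_bigr do rewrite coset_maxU.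
rewrite cV cS !exprD -mulrA.
have tS : 0 <= (1 + tau) ^+ #|S| by rewrite exprn_ge0 // addr_ge0 // ltW.
apply: le_trans (ler_wpM2l tS (sum_max_translate _ _ _ VS yw)) _.
have aS : 0 <= 2 * a ^+ #|supp y :\: S| by rewrite mulr_ge0 // exprn_ge0.
rewrite mulrCA; apply: le_trans (ler_wpM2l aS VM) _.
by rewrite natrM le_eqVlt; apply/orP; left; apply/eqP; ring.
Qed.

(** A coordinate missed by [S] would vanish on the whole dual code and put its unit vector into [C].
    Hence [S] is everything and (1 + tau)^n cancels. *)
Lemma sum_coset_max_dual C : is_linear_code C -> pc_density_le w C ->
  (forall j, delta_mx 0 j \notin C) ->
  \sum_x coset_max (dual_code C) x <= #|dual_code C|%:R * a ^+ n.
Proof.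
move=> lC [m [P [Pw CP]]] Cdelta.
have [|V [S [lV ysV Vmin SV [VM VS]]]] := sum_coset_max_span [seq row i P | i : 'I_m].
  by move=> y /mapP[i _ ->].
have VC : V = dual_code C.
  apply/eqP; rewrite finset.eqEsubset; apply/andP; split.
    apply: Vmin => [|y /mapP[i _ ->]].
      by split; [exact: (@dual_code0 R)|move=> x y; exact: (@dual_codeD R)].
    by rewrite CP inE row_sub.
  rewrite CP; apply/fintype.subsetP => y; rewrite inE => /submxP[D ->].
  rewrite mulmx_sum_row; elim/big_ind: _ => [||i _]; [exact: lV.1|exact: lV.2|].
  case: (F2_cases (D 0 i)) => ->; first by rewrite scale0r; exact: lV.1.
  by rewrite scale1r; apply: ysV; apply: map_f; rewrite mem_enum.
have ST : S = [set: 'I_n].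
  apply/setP => j; rewrite inE; apply: contraTT isT => jS /=.
  case/negP: (Cdelta j); apply: (@dual_dual_code R) => // y; rewrite -VC => /VS yS.
  rewrite chiC chi_delta; suff -> : y 0 j != 0 = false by rewrite mulr0 subr0.
  by apply: contraNF jS => yj; apply: (fintype.subsetP yS); rewrite inE.
move: VM; rewrite ST VC cardsT card_ord [leRHS]mulrC ler_pM2l //.
by rewrite exprn_gt0 // addr_gt0.
Qed.

End CosetMaximum.

(** * The asymptotic rate *)

Section Rate.
Context {R : realType}.

Lemma exists_hwt (n k : nat) : (k <= n)%N -> exists x : 'rV['F_2]_n, hwt x = k.
Proof.
move=> kn; exists (ind [set widen_ord kn i | i : 'I_k]).
rewrite hwt_ind card_imset ?card_ord // => i j /(congr1 val) /= ij; exact: val_inj.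
Qed.

(** The case s = 1, p = q = 1 reads 2 <= 2a. *)
Lemma block_bound_ge1 (tau a : R) (w : nat) : (0 < w)%N -> 0 < tau -> tau <= 1 ->
  block_bound tau w a -> 1 <= a.
Proof.
move=> w0 t0 t1 /(_ 1%N 1 1 w0 ler01 ler01).
rewrite !big_ord_recr big_ord0 /= bin0 binn !mulr1 !mul1r !expr0 add0r.
rewrite !expr1 (max_idPl t1) (max_idPr t1) => H.
have t : tau ^+ (w - 1) <= 1 by rewrite exprn_ile1 // ltW.
by have := H t t; lra.
Qed.

(** With D = delta n and the eigenvalue of [radial_profile], the left factor in [covering_fraction]
    is exactly 1, so at least 2^n / n vectors lie in cosets of the dual code meeting the ball of
    radius r. Weighting these by tau^r gives the upper bound. *)
Lemma code_bound (delta sigma tau a : R) (w : nat) : 0 < delta -> delta < 1 / 2 ->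
  1 / 2 - Num.sqrt (delta * (1 - delta)) < sigma ->
  0 < tau -> tau <= 1 -> 0 < a -> block_bound tau w a ->
  exists N : nat, forall n : nat, (N <= n)%N -> forall C : {set 'rV['F_2]_n},
    admissible w delta C -> ln #|C|%:R <= ln n%:R + (ln a - sigma * ln tau) * n%:R.
Proof.
move=> d0 d1 rs t0 t1 a0 wa; have [N HN] := radial_profile _ _ d0 d1 rs.
exists (maxn N (Num.truncn (1 / delta)).+1) => n; rewrite geq_max => /andP[nN nd] C.
have {}nd : 1 < delta * n%:R.
  rewrite -ltr_pdivrMl // mulrC; apply: lt_le_trans (truncnS_gt _) _.
  by rewrite ler_nat.
have n0 : 0 < n%:R :> R by nra.
move=> [lC [pC [d [dd Cd]]]]; have [r [g [rs' g0 gr [k kn gk] gadj]]] := HN n nN.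
have CD x : x \in C -> x != 0 -> delta * n%:R <= (hwt x)%:R.
  by move=> xC x0; apply: le_trans dd _; rewrite ler_nat; apply: Cd.
(* Unit vectors have weight 1 < delta n. *)
have Cdelta j : delta_mx 0 j \notin C.
  apply/negP => /CD H; move: H; rewrite /hwt -/(supp _) supp_delta cards1 => H.
  suff /H : delta_mx 0 j != 0 :> 'rV['F_2]_n by lra.
  by apply/eqP => /rowP /(_ j) /eqP; rewrite !mxE !eqxx.
have cov := covering_fraction C (fun x => g (hwt x)) ((1 - 2 * delta) * n%:R + 1)
  (delta * n%:R) lC CD.
have {cov} := cov _ (fun x => g0 (hwt x)); set S := [set x | _] => cov.
have {}cov : (2 ^ n)%:R <= n%:R * #|S|%:R :> R.
  have : ((1 - 2 * delta) * n%:R + 1 - n%:R + 2 * (delta * n%:R)) * (2 ^ n)%:R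
      <= 2 * (delta * n%:R) * #|S|%:R :> R.
    apply: cov; first by lra.
    - by have [x xk] := exists_hwt _ _ kn; exists x; rewrite xk.
    - move=> x; rewrite adj_radial; apply: gadj.
      by apply: leq_trans (max_card _) _; rewrite card_ord.
  have -> : (1 - 2 * delta) * n%:R + 1 - n%:R + 2 * (delta * n%:R) = 1 by ring.
  rewrite mul1r => H; apply: le_trans H _; apply: ler_wpM2r => //; nra.
have SM : #|S|%:R * tau ^+ r <= #|dual_code C|%:R * a ^+ n.
  apply: le_trans (sum_coset_max_dual tau t0 t1 w a (ltW a0) wa C lC pC Cdelta).
  rewrite mulr_natl -sumr_const big_mkcond /=; apply: ler_sum => x _.
  case: ifP => [|_]; last exact: coset_max_ge0.
  rewrite inE => /existsP[z /andP[zV gz]].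
  apply: le_trans (coset_max_ge tau _ x _ zV); apply: ler_wiXn2l; rewrite ?(ltW t0) //.
  by rewrite leqNgt; apply: contraNN gz => /gr ->.
have C0 : (0 < #|C|)%N by apply/card_gt0P; exists 0; exact: lC.1.
have V0 : (0 < #|dual_code C|)%N by apply/card_gt0P; exists 0; apply: (@dual_code0 R).
have CV : #|C|%:R * #|dual_code C|%:R = (2 ^ n)%:R :> R.
  by rewrite -natrM (@card_dual_code R).
have tr : 0 < tau ^+ r by rewrite exprn_gt0.
have {}cov : #|C|%:R * tau ^+ r <= n%:R * a ^+ n.
  have V0R : 0 < #|dual_code C|%:R :> R by rewrite ltr0n.
  rewrite -(ler_pM2r V0R) mulrAC CV -[leRHS]mulrA [a ^+ n * _]mulrC.
  apply: le_trans (ler_wpM2r (ltW tr) cov) _.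
  by rewrite -mulrA ler_pM2l.
have : ln (#|C|%:R * tau ^+ r) <= ln (n%:R * a ^+ n).
  by rewrite ler_ln // posrE mulr_gt0 // ?ltr0n // exprn_gt0.
have -> : ln (#|C|%:R * tau ^+ r) = ln #|C|%:R + r%:R * ln tau :> R.
  by rewrite lnM ?posrE ?ltr0n // lnXn // mulr_natl.
have -> : ln (n%:R * a ^+ n) = ln n%:R + n%:R * ln a :> R.
  by rewrite lnM ?posrE ?exprn_gt0 // lnXn // mulr_natl.
have := ler_wnM2r (ln_le0 t1) rs'; lra.
Qed.

(** Let sigma decrease to rho in [code_bound]; the term ln n / n disappears in the limit. *)
Lemma Rw_le (delta tau a : R) (w : nat) : 0 < delta -> delta < 1 / 2 -> (0 < w)%N ->
  0 < tau -> tau <= 1 -> block_bound tau w a ->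
  (Rw w delta <=
    ((ln a - (1 / 2 - Num.sqrt (delta * (1 - delta))) * ln tau) / ln 2)%:E)%E.
Proof.
move=> d0 d1 w0 t0 t1 wa; set rho := 1 / 2 - Num.sqrt _.
have a1 := block_bound_ge1 _ _ _ w0 t0 t1 wa.
have l2 : 0 < ln 2 :> R by rewrite ln_gt0 // ltr1n.
have lt0 : ln tau <= 0 by apply: ln_le0.
have la0 : 0 <= ln a by apply: ln_ge0.
apply/lee_addgt0Pr => e e0.
(* Half of the error, in natural logarithms, goes to ln n and half to sigma. *)
have [e1 e10 e1E] : exists2 e1, 0 < e1 & e1 = e * ln 2 / 2.
  by exists (e * ln 2 / 2); rewrite // divr_gt0 // mulr_gt0.
(* The divisor is at least 1, even for tau = 1, and makes the excess of sigma cost at most [e1]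
   after multiplication by - ln tau. *)
pose sigma := rho + e1 / (1 - ln tau).
have rs : rho < sigma by rewrite ltrDl divr_gt0 //; lra.
have a0 : 0 < a by lra.
have [N HN] := code_bound _ _ _ _ _ d0 d1 rs t0 t1 a0 wa.
(* For q = sqrt n >= 2 / e1, ln n = 2 ln q <= 2q <= e1 n. *)
pose K := 4 / e1 ^+ 2.
apply: (@le_trans _ _ (ereal_sup ((fun n => (best_rate w delta n)%:E) @`
    [set n | (maxn N (Num.truncn K).+1 <= n)%N]%classic))).
  apply: ereal_inf_lbound; exists [set n | (maxn N (Num.truncn K).+1 <= n)%N]%classic => //.
  by exists (maxn N (Num.truncn K).+1).
apply: ge_ereal_sup => _ [n /= + <-]; rewrite geq_max => /andP[nN nK].
have nKR : K <= n%:R by apply: ltW; apply: lt_le_trans (truncnS_gt _) _; rewrite ler_nat.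
have n0 : 0 < n%:R :> R by rewrite ltr0n; apply: leq_trans nK.
have lnn : ln n%:R <= e1 * n%:R.
  pose q := Num.sqrt (n%:R : R).
  have q0 : 0 < q by rewrite sqrtr_gt0.
  have qn : n%:R = q ^+ 2 by rewrite sqr_sqrtr // ltW.
  have q2 : 2 <= e1 * q.
    rewrite -(@ler_pXn2r _ 2%N) ?nnegrE ?mulr_ge0 ?(ltW e10) ?(ltW q0) //.
    move: nKR; rewrite qn /K ler_pdivrMr ?exprn_gt0 // exprMn; lra.
  rewrite qn lnXn // mulr2n; have := ln_sublinear q0; nra.
have sl : - (sigma * ln tau) <= - (rho * ln tau) + e1.
  rewrite /sigma mulrDl opprD lerD2l -mulNr.
  have -> : - (e1 / (1 - ln tau)) * ln tau = e1 * (- ln tau / (1 - ln tau)) by field; lra.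
  rewrite -[leRHS]mulr1 ler_pM2l // ler_pdivrMr; lra.
rewrite -EFinD lee_fin.
have B : (ln a - rho * ln tau) / ln 2 + e = (ln a - rho * ln tau + 2 * e1) / ln 2.
  by rewrite e1E; field; rewrite gt_eqF.
have r0 : 0 <= rho.
  rewrite subr_ge0 -(@ler_pXn2r _ 2%N) ?nnegrE ?sqrtr_ge0 ?sqr_sqrtr //; nra.
(* The maximum defaults to 0, so the bound itself must be nonnegative. *)
rewrite B; apply: bigmax_le => [|C /asboolP HC].
  by rewrite divr_ge0 // ?(ltW l2) //; nra.
rewrite /rate /log2 ler_pdivrMr // mulrAC ler_pM2r ?invr_gt0 //.
have := HN n nN C HC; nra.
Qed.

End Rate.

(** * Growth of coset maxima along a parity check *)

Section BlockBounds.
Context {R : realType}.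
Implicit Types (tau a p q : R).

(** In each maximum the smaller entry is at least tau^w times the larger, so 1 + tau^w times the
    maximum is at most the sum of the two entries. The binomial theorem then evaluates the total,
    and s <= w allows comparison with a^s. *)
Lemma block_bound_general tau a (w : nat) : (0 < w)%N -> 0 < tau -> tau <= 1 -> 0 <= a ->
  a ^+ w * (1 + tau ^+ w) = (1 + tau) ^+ w -> block_bound tau w a.
Proof.
move=> w0 t0 t1 a0 aw s p q sw p0 q0 pq qp.
have tw : 0 < 1 + tau ^+ w by rewrite addr_gt0 // exprn_gt0.
have sum_le : (1 + tau ^+ w) *
    \sum_(k < s.+1) 'C(s, k)%:R * Num.max (tau ^+ k * p) (tau ^+ (s - k) * q) <=
    (1 + tau) ^+ s * (p + q).
  have -> : (1 + tau) ^+ s * (p + q) =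
      \sum_(k < s.+1) 'C(s, k)%:R * (tau ^+ k * p + tau ^+ (s - k) * q).
    rewrite mulrDr {1}exprDn [in X in _ + X]addrC exprDn !mulr_suml -big_split /=.
    apply: eq_bigr => k _; rewrite !expr1n mulr1 mul1r mulrDr.
    by rewrite !mulr_natl !mulrnAl.
  rewrite mulr_sumr; apply: ler_sum => k _; rewrite mulrCA ler_wpM2l //.
  have ks : (k <= s)%N by rewrite -ltnS.
  have E : tau ^+ w = tau ^+ (s - k) * tau ^+ k * tau ^+ (w - s).
    by rewrite -!exprD subnK // subnKC.
  have tk : 0 <= tau ^+ k by rewrite exprn_ge0 // ltW.
  have tsk : 0 <= tau ^+ (s - k) by rewrite exprn_ge0 // ltW.
  have tk1 : tau ^+ k <= 1 by rewrite exprn_ile1 // ltW.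
  have tsk1 : tau ^+ (s - k) <= 1 by rewrite exprn_ile1 // ltW.
  rewrite mulrDl mul1r; case: (leP (tau ^+ k * p)) => _.
    rewrite addrC lerD2r E.
    have -> : tau ^+ (s - k) * tau ^+ k * tau ^+ (w - s) * (tau ^+ (s - k) * q) =
      tau ^+ k * (tau ^+ (s - k) * tau ^+ (s - k) * (tau ^+ (w - s) * q)) by ring.
    rewrite ler_wpM2l //; apply: le_trans qp; rewrite ler_piMl //.
      by rewrite mulr_ge0 // exprn_ge0 // ltW.
    by rewrite mulr_ile1.
  rewrite lerD2l E.
  have -> : tau ^+ (s - k) * tau ^+ k * tau ^+ (w - s) * (tau ^+ k * p) =
    tau ^+ (s - k) * (tau ^+ k * tau ^+ k * (tau ^+ (w - s) * p)) by ring.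
  rewrite ler_wpM2l //; apply: le_trans pq; rewrite ler_piMl //.
    by rewrite mulr_ge0 // exprn_ge0 // ltW.
  by rewrite mulr_ile1.
have ts : (1 + tau) ^+ s <= (1 + tau ^+ w) * a ^+ s.
  (* Taking w-th powers reduces the claim to (1 + tau^w)^s <= (1 + tau^w)^w. *)
  rewrite -(@ler_pXn2r _ w) ?nnegrE ?mulr_ge0 ?exprn_ge0 ?addr_ge0 ?exprn_ge0 ?(ltW t0) //.
  rewrite exprMn ![(_ ^+ s) ^+ w]exprAC -aw exprMn [leRHS]mulrC ler_wpM2l ?exprn_ge0 //.
  by rewrite ler_weXn2l // lerDl exprn_ge0 // ltW.
rewrite -(ler_pM2l tw); apply: le_trans sum_le _.
by rewrite mulrA ler_wpM2r // addr_ge0.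
Qed.

Lemma le_of_expr_le (x y : R) (k : nat) : (0 < k)%N -> 0 <= x -> 0 <= y ->
  x ^+ k <= y ^+ k -> x <= y.
Proof. by move=> k0 x0 y0; rewrite ler_pXn2r. Qed.

Lemma max_le2 (b c x : R) : b <= x -> c <= x -> Num.max b c <= x.
Proof. by move=> ? ?; rewrite ge_max; apply/andP. Qed.

(** The case s = 1, with c = tau^(w - 1). The left side is at most one of (1 + tau) p, (1 + tau) q
    and p + q, while (1 + c) p and (1 + c) q are at most p + q. *)
Lemma block_bound_one tau c a p q : 0 <= tau -> tau <= 1 -> 0 <= p -> 0 <= q ->
  c * p <= q -> c * q <= p -> 1 <= a -> 1 + tau <= a * (1 + c) ->
  Num.max p (tau * q) + Num.max (tau * p) q <= a * (p + q).
Proof.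
move=> t0 t1 p0 q0 pq qp a1 ac.
have a0 : 0 <= a by lra.
have P : (1 + tau) * p <= a * (p + q).
  apply: le_trans (ler_wpM2r p0 ac) _.
  by rewrite -mulrA ler_wpM2l // mulrDl mul1r lerD2l.
have Q : (1 + tau) * q <= a * (p + q).
  apply: le_trans (ler_wpM2r q0 ac) _.
  by rewrite -mulrA ler_wpM2l // mulrDl mul1r [leRHS]addrC lerD2l.
have S : p + q <= a * (p + q) by rewrite ler_peMl // addr_ge0.
have tp : tau * p <= p by rewrite ler_piMl.
have tq : tau * q <= q by rewrite ler_piMl.
by case: (leP p) => _; case: (leP (tau * p)) => _; lra.
Qed.

(** The case s = 2, with c = tau^(w - 2) and [a] in the role of a^2. The outer maxima are p and q,
    so only the middle term is left for (a - 1)(p + q). *)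
Lemma block_bound_two tau c a p q : 0 <= tau -> tau <= 1 -> 0 <= p -> 0 <= q ->
  c * p <= q -> c * q <= p -> tau ^+ 2 * p <= q -> tau ^+ 2 * q <= p ->
  1 <= a -> 2 * tau <= (a - 1) * (1 + c) ->
  Num.max p (tau ^+ 2 * q) + 2 * Num.max (tau * p) (tau * q) + Num.max (tau ^+ 2 * p) q
    <= a * (p + q).
Proof.
move=> t0 t1 p0 q0 pq qp tpq tqp a1 ac.
rewrite (max_idPl tqp) (max_idPr tpq).
have a0 : 0 <= a - 1 by lra.
have P : 2 * tau * p <= (a - 1) * (p + q).
  apply: le_trans (ler_wpM2r p0 ac) _.
  by rewrite -mulrA ler_wpM2l // mulrDl mul1r lerD2l.
have Q : 2 * tau * q <= (a - 1) * (p + q).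
  apply: le_trans (ler_wpM2r q0 ac) _.
  by rewrite -mulrA ler_wpM2l // mulrDl mul1r [leRHS]addrC lerD2l.
by case: (leP (tau * p)) => _; lra.
Qed.

(** The value of a^3 comes from s = 3: there p = q, and the maxima p, tau p, tau q, q with weights
    1, 3, 3, 1 give equality. Smaller s are checked by polynomial inequalities. *)
Lemma block_bound3 tau a : 0 < tau -> tau <= 1 -> 0 <= a ->
  a ^+ 3 = 1 + 3 * tau -> block_bound tau 3 a.
Proof.
move=> t0 t1 a0 a3.
have tk k : 0 <= tau ^+ k by rewrite exprn_ge0 // ltW.
have t00 := ltW t0.
have a1 : 1 <= a by apply: (le_of_expr_le _ _ 3) => //; rewrite expr1n a3; lra.
have aT : a <= 1 + tau.
  apply: (le_of_expr_le _ _ 3) => //; rewrite ?addr_ge0 // a3.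
  by have := (tk 2%N, tk 3%N); case=> ? ?; lra.
have b : ('C(3, 1) = 3)%N * ('C(3, 2) = 3)%N * ('C(2, 1) = 2)%N by [].
case=> [|[|[|[|//]]]] p q _ p0 q0; rewrite !big_ord_recr big_ord0 /= add0r
  ?subSS ?subn0 ?subnn ?b ?bin0 ?binn ?expr0 ?expr1 ?mul1r => pq qp.
- by apply: max_le2; lra.
- apply: (block_bound_one _ (tau ^+ 2)) => //.
  apply: (le_of_expr_le _ _ 3); rewrite ?mulr_ge0 ?addr_ge0 // exprMn a3.
  by have := (tk 2, tk 3, tk 4, tk 5, tk 6, tk 7)%N; do 5!case; move=> *; lra.
- have tt x : 0 <= x -> tau ^+ 2 * x <= tau * x.
    by move=> x0; rewrite expr2 -mulrA ler_piMl // mulr_ge0.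
  apply: (block_bound_two _ tau) => //; first by apply: le_trans pq; apply: tt.
  + by apply: le_trans qp; apply: tt.
  + by rewrite exprn_ege1.
  + suff : 1 + 3 * tau <= a ^+ 2 * (1 + tau) by lra.
    by rewrite -a3 exprSr ler_wpM2l // exprn_ge0.
- have -> : q = p by lra.
  rewrite a3 (max_idPl _) 1?(max_idPl _) 1?(max_idPr _) 1?(max_idPr _) //; first lra.
  all: rewrite ?ler_piMl ?exprn_ile1 // expr2 -mulrA ler_piMl // mulr_ge0 //.
Qed.

(** For s = 4, p = q and the sum is (2 + 8 tau + 6 tau^2) p, below 2 a^4 p. For s = 3 the ratio of p
    and q is within a factor tau, so the sum is (1 + 3 tau)(p + q). *)
Lemma block_bound4 tau a : 0 < tau -> tau <= 1 -> 0 <= a ->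
  a ^+ 4 = 1 + 4 * tau + 6 * tau ^+ 2 -> block_bound tau 4 a.
Proof.
move=> t0 t1 a0 a4.
have tk k : 0 <= tau ^+ k by rewrite exprn_ge0 // ltW.
have t00 := ltW t0.
have tS k x : 0 <= x -> tau ^+ k.+1 * x <= tau ^+ k * x.
  by move=> x0; rewrite exprS -mulrA ler_piMl // mulr_ge0.
have a1 : 1 <= a.
  by apply: (le_of_expr_le _ _ 4) => //; rewrite expr1n a4; have := tk 2%N; lra.
have b : ('C(3, 1) = 3)%N * ('C(3, 2) = 3)%N * ('C(4, 1) = 4)%N * ('C(4, 2) = 6)%N *
  ('C(4, 3) = 4)%N * ('C(2, 1) = 2)%N by [].
case=> [|[|[|[|[|//]]]]] p q _ p0 q0; rewrite !big_ord_recr big_ord0 /= add0r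
  ?subSS ?subn0 ?subnn ?b ?bin0 ?binn ?expr0 ?expr1 ?mul1r => pq qp.
- by apply: max_le2; lra.
- apply: (block_bound_one _ (tau ^+ 3)) => //.
  apply: (le_of_expr_le _ _ 4); rewrite ?mulr_ge0 ?addr_ge0 // exprMn a4.
  have := (tk 2, tk 3, tk 4, tk 5, tk 6, tk 7, tk 8, tk 9, tk 10, tk 11, tk 12, tk 13, tk 14)%N.
  by do 12!case; move=> *; lra.
- apply: (block_bound_two _ (tau ^+ 2)) => //; first by rewrite exprn_ege1.
  suff : (1 + tau) ^+ 2 <= a ^+ 2 * (1 + tau ^+ 2) by lra.
  apply: (le_of_expr_le _ _ 2); rewrite ?mulr_ge0 ?addr_ge0 ?exprn_ge0 ?addr_ge0 //.
  rewrite [leRHS]exprMn -(exprM a) a4.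
  by have := (tk 2, tk 3, tk 4, tk 5, tk 6)%N; do 4!case; move=> *; lra.
- have A : 1 + 3 * tau <= a ^+ 3.
    apply: (le_of_expr_le _ _ 4); rewrite ?addr_ge0 ?exprn_ge0 ?mulr_ge0 //.
    rewrite -exprM mulnC exprM a4.
    by have := (tk 2, tk 3, tk 4, tk 5, tk 6)%N; do 4!case; move=> *; lra.
  have E x : 0 <= x -> tau ^+ 3 * x <= tau * x /\ tau ^+ 2 * x <= tau * x.
    move=> x0; have := (tS 1%N x x0, tS 2%N x x0); rewrite expr1 => -[? ?]; split; lra.
  have [? ?] := E p p0; have [? ?] := E q q0.
  have M1 : Num.max p (tau ^+ 3 * q) <= p by apply: max_le2; lra.
  have M2 : Num.max (tau * p) (tau ^+ 2 * q) <= tau * p.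
    by apply: max_le2; rewrite // expr2 -mulrA ler_wpM2l.
  have M3 : Num.max (tau ^+ 2 * p) (tau * q) <= tau * q.
    by apply: max_le2; rewrite // expr2 -mulrA ler_wpM2l.
  have M4 : Num.max (tau ^+ 3 * p) q <= q by apply: max_le2; lra.
  have : (1 + 3 * tau) * (p + q) <= a ^+ 3 * (p + q) by rewrite ler_wpM2r // addr_ge0.
  lra.
- have -> : q = p by lra.
  have := (tS 0%N p p0, tS 1%N p p0, tS 2%N p p0, tS 3%N p p0).
  rewrite expr0 expr1 mul1r a4 => -[[[? ?] ?] ?].
  have M1 : Num.max p (tau ^+ 4 * p) <= p by apply: max_le2; lra.
  have M2 : Num.max (tau * p) (tau ^+ 3 * p) <= tau * p by apply: max_le2; lra.
  have M4 : Num.max (tau ^+ 3 * p) (tau * p) <= tau * p by apply: max_le2; lra.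
  have M5 : Num.max (tau ^+ 4 * p) p <= p by apply: max_le2; lra.
  rewrite maxxx; have := mulr_ge0 (tk 2%N) p0; lra.
Qed.

End BlockBounds.

(** * Choice of the parameters and the three bounds *)

Lemma ln_root (R : realType) (A : R) (w : nat) : (0 < w)%N -> 0 < A ->
  exists a : R, [/\ 0 <= a, a ^+ w = A & ln a = w%:R^-1 * ln A].
Proof.
move=> w0 A0; exists (expR (w%:R^-1 * ln A)); split; rewrite ?expR_ge0 ?expRK //.
by rewrite -expRM_natl mulrA divff ?mul1r ?lnK ?posrE // pnatr_eq0 -lt0n.
Qed.

Theorem theorem4 (R : realType) (delta : R) :
  0 < delta -> delta < 1 / 2 ->
  let rho := 1 / 2 - Num.sqrt (delta * (1 - delta)) in
  (forall w : nat, (3 <= w)%N ->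
     (Rw w delta <= (H2 rho - w%:R^-1 * log2 (1 + (rho / (1 - rho)) ^+ w))%:E)%E)
  /\ (Rw 3 delta <=
        (if delta <= 1 / 2 - Num.sqrt 3 / 4 then 2 / 3 else 2 / 3 * H4 (3 * rho))%:E)%E
  /\ (Rw 4 delta <= (H2 rho + 4^-1 * log2 (Fpoly rho))%:E)%E.
Proof.
move=> d0 d1 rho.
have Rw_rho w tau a := @Rw_le R delta tau a w d0 d1.
rewrite -/rho in Rw_rho.
set s := Num.sqrt _ in rho Rw_rho *.
have ss : s ^+ 2 = delta * (1 - delta) by rewrite sqr_sqrtr //; nra.
have s0 : 0 < s by rewrite sqrtr_gt0; nra.
have s1 : s < 1 / 2 by rewrite -(@ltr_pXn2r _ 2%N) ?nnegrE ?ss //; nra.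
have [r0 r1] : 0 < rho /\ rho < 1 / 2 by rewrite /rho; split; lra.
have rE : rho = 1 / 2 - s by [].
clearbody rho.
have l2 : 0 < ln 2 :> R by rewrite ln_gt0 // ltr1n.
have l4 : ln 4 = 2 * ln 2 :> R.
  by rewrite (_ : 4 = 2 ^+ 2) ?lnXn // ?mulr_natl // -natrX.
(* [t] minimises ln (1 + tau) - rho ln tau, and the minimum is H(rho) ln 2. *)
pose t := rho / (1 - rho).
have t0 : 0 < t by rewrite divr_gt0 //; lra.
have t1 : t <= 1 by rewrite ler_pdivrMr; lra.
have lt : ln t = ln rho - ln (1 - rho) by rewrite ln_div // posrE; lra.
have l1t : ln (1 + t) = - ln (1 - rho).
  have -> : 1 + t = (1 - rho)^-1 by rewrite /t; field; rewrite gt_eqF //; lra.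
  by rewrite lnV // posrE; lra.
split=> [w w3|].
  have w0 : (0 < w)%N by apply: leq_trans w3.
  have tw : 0 < 1 + t ^+ w by rewrite addr_gt0 // exprn_gt0.
  have t1w : 0 < (1 + t) ^+ w by rewrite exprn_gt0 // addr_gt0.
  have [a [a0 aw la]] := @ln_root R ((1 + t) ^+ w / (1 + t ^+ w)) w w0 (divr_gt0 t1w tw).
  apply: le_trans (Rw_rho w t a w0 t0 t1 _) _.
    by apply: block_bound_general => //; rewrite aw divfK // gt_eqF.
  rewrite lee_fin la ln_div ?posrE // lnXn ?addr_gt0 // l1t lt /H2 /log2 -/t.
  rewrite -mulr_natl le_eqVlt; apply/orP; left; apply/eqP.
  by field; rewrite (gt_eqF l2) pnatr_eq0 -lt0n.
split.
  case: ifPn => [_|].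
    (* With tau = 1 and a^3 = 4 the bound is log2(4) / 3 = 2/3. *)
    have [a [a0 aw la]] := @ln_root R 4 3 isT ltac:(by []).
    apply: le_trans (Rw_rho 3%N 1 a isT ltr01 (lexx 1) _) _.
      by apply: block_bound3 => //; rewrite aw; lra.
    rewrite lee_fin ln1 la l4 le_eqVlt; apply/orP; left; apply/eqP.
    by field; rewrite gt_eqF.
  rewrite -ltNge => dq.
  (* s^2 = 1/4 - (1/2 - delta)^2 exceeds 1/4 - 3/16 = 1/16, so s > 1/4. *)
  have r4 : rho < 1 / 4.
    have u3 : Num.sqrt 3 ^+ 2 = 3 :> R by rewrite sqr_sqrtr.
    have dd : (1 / 2 - delta) ^+ 2 < (Num.sqrt 3 / 4) ^+ 2.
      by rewrite ltr_pXn2r ?nnegrE //; lra.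
    have : (1 / 4) ^+ 2 < s ^+ 2 by rewrite ss; move: dd; rewrite expr_div_n u3; lra.
    by rewrite ltr_pXn2r ?nnegrE ?(ltW s0) //; lra.
  (* The minimiser of ln (1 + 3 tau) / 3 - rho ln tau; it is at most 1 because rho < 1/4. *)
  pose tau := rho / (1 - 3 * rho).
  have tau0 : 0 < tau by rewrite divr_gt0 //; lra.
  have tau1 : tau <= 1 by rewrite ler_pdivrMr; lra.
  have E : 1 + 3 * tau = (1 - 3 * rho)^-1 by rewrite /tau; field; rewrite gt_eqF //; lra.
  have A0 : 0 < 1 + 3 * tau by lra.
  have [a [a0 aw la]] := @ln_root R (1 + 3 * tau) 3 isT A0.
  apply: le_trans (Rw_rho 3%N tau a isT tau0 tau1 _) _; first exact: block_bound3.
  have -> : ln tau = ln rho - ln (1 - 3 * rho) by rewrite ln_div // posrE; lra.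
  rewrite lee_fin la E lnV ?posrE; last lra.
  rewrite /H4 /log4 l4 lnM ?posrE // le_eqVlt; apply/orP; left; apply/eqP.
  by field; rewrite gt_eqF.
(* With tau = t, the fourth root of the denominator restores the term - ln (1 - rho) that completes
   H(rho). *)
have F0 : 1 + 4 * t + 6 * t ^+ 2 = Fpoly rho / (1 - rho) ^+ 4.
  by rewrite /Fpoly /t; field; rewrite gt_eqF //; lra.
have A0 : 0 < 1 + 4 * t + 6 * t ^+ 2 by have := sqr_ge0 t; lra.
have R4 : 0 < (1 - rho) ^+ 4 by rewrite exprn_gt0 //; lra.
have Fp : 0 < Fpoly rho by move: A0; rewrite F0 pmulr_lgt0 // invr_gt0.
have [a [a0 aw la]] := @ln_root R (1 + 4 * t + 6 * t ^+ 2) 4 isT A0.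
apply: le_trans (Rw_rho 4%N t a isT t0 t1 _) _; first exact: block_bound4.
rewrite lee_fin la F0 ln_div ?posrE // lnXn; last lra.
rewrite lt /H2 /log2 -mulr_natl le_eqVlt; apply/orP; left; apply/eqP.
by field; rewrite gt_eqF.
Qed.
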